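(* Let $M$ be a finite subset of $L_1$, let $r>0$ be a constant, and let $\varpi_0$ and $\varpi_1$ be concave non-decreasing continuous functions on $[0,\infty)$ (with values in $[0,\infty)$) vanishing only at $0$, such that for all $t>0$ $$|\varpi_0(t)-\varpi_1(t)|\le 2r.$$ Define the metrics $d_i(x,y)=\varpi_i(\|x-y\|)$ on $M$, $i=0,1$. Then the $r$-twisted union $(M\times\mathbb{F}_2,d)$ of $(M,\varpi_0(\|x-y\|))$ and $(M,\varpi_1(\|x-y\|))$ embeds into $L_1$ with distortion $D$ bounded by an absolute constant; specifically, $D\le 1+2.776\,\Delta<26.6$.
   Context: $\mathbb{F}_2=\{0,1\}$. $L_1$ stands for a space $L_1(\Omega,\Sigma,\mu)$, with its norm $\|\cdot\|$; embedding into $L_1$ means embedding into some such space. An injective map $F:(X,d_X)\to(Y,d_Y)$ between metric spaces is a bilipschitz embedding if there are $C_1,C_2>0$ with $C_1d_X(u,v)\le d_Y(F(u),F(v))\le C_2d_X(u,v)$ for all $u,v\in X$; its distortion is $\mathrm{Lip}(F)\cdot\mathrm{Lip}(F^{-1}|_{F(X)})$, where $\mathrm{Lip}$ denotes the Lipschitz constant. $\Delta$ denotes a universal constant (whose existence is due to Mendel and Naor), $\Delta\le(2\sqrt2+3)e/(e-1)<10$, such that for every concave non-decreasing function $\omega:[0,\infty)\to[0,\infty)$ with $\omega(0)=0$ and $\omega(t)>0$ for $t>0$, the metric space $(L_1,\omega(\|x-y\|_1))$ embeds into $L_1$ with distortion at most $\Delta$. Twisted union: Let $M$ be a finite set endowed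 with two metrics $d_0,d_1$ and let $r>0$ be a constant such that $|d_0(x,y)-d_1(x,y)|\le 2r$ for all $x,y\in M$. The $r$-twisted union of $(M,d_0)$ and $(M,d_1)$ is the set $M\times\mathbb{F}_2$ with the metric $d$ defined as the shortest path metric of the weighted graph on $M\times\mathbb{F}_2$ with the following edges: for all $x,y\in M$, an edge between $(x,0)$ and $(y,0)$ of weight $d_0(x,y)$; for all $x,y\in M$, an edge between $(x,1)$ and $(y,1)$ of weight $d_1(x,y)$; for every $x\in M$, an edge between $(x,0)$ and $(x,1)$ of weight $r$. *)

(* Defs.v *)
From HB Require Import structures.
From mathcomp Require Import all_boot all_order all_algebra.
From mathcomp Require Import all_classical all_reals all_analysis.

Set Implicit Arguments.
Unset Strict Implicit.
Unset Printing Implicit Defensive.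

Import Order.TTheory GRing.Theory Num.Theory.
Import numFieldNormedType.Exports.

Local Open Scope classical_set_scope.
Local Open Scope ring_scope.

(* A metric on a type [X] is given by its distance function [X -> X -> R]. *)

Section Embeddings.
Context {R : realType}.

(* The Lipschitz constant, [+oo] for a map that is not Lipschitz. *)
Definition Lip (X Y : Type) (dX : X -> X -> R) (dY : Y -> Y -> R)
    (f : X -> Y) : \bar R :=
  ereal_inf (EFin @`
    [set C : R | 0 <= C /\ forall u v, dY (f u) (f v) <= C * dX u v]).

Definition range_inv (X Y : Type) (F : X -> Y) (y : range F) : X :=
  s2val (cid2 (set_valP y)).

Definition bilipschitz_embedding (X Y : Type) (dX : X -> X -> R)
    (dY : Y -> Y -> R) (F : X -> Y) : Prop :=
  injective F /\
  exists C1 C2 : R, [/\ 0 < C1, 0 < C2 &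
    forall u v, C1 * dX u v <= dY (F u) (F v) <= C2 * dX u v].

Definition distortion (X Y : Type) (dX : X -> X -> R) (dY : Y -> Y -> R)
    (F : X -> Y) : \bar R :=
  (Lip dX dY F *
   Lip (fun y z : range F => dY (set_val y) (set_val z)) dX
       (@range_inv X Y F))%E.

(* ||f - g||_1; the points of [LspaceType1 mu] are classes of functions
   modulo equality almost everywhere. *)
Definition L1dist d (T : measurableType d) (mu : {measure set T -> \bar R})
    (f g : LspaceType1 mu) : R :=
  fine ('N[mu]_1[EFin \o (fun x => f x - g x)%R])%E.

Definition embeds_into_L1 (X : Type) (dX : X -> X -> R) (D : R) : Prop :=
  exists (d : measure_display) (T : measurableType d)
    (mu : {measure set T -> \bar R}) (F : X -> LspaceType1 mu),
    bilipschitz_embedding dX (@L1dist d T mu) F /\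
    (distortion dX (@L1dist d T mu) F <= D%:E)%E.

(* Functions on [0, +oo) are functions on [R] of which only the values on
   [0, +oo) matter. *)
Definition concave_modulus (w : R -> R) : Prop :=
  [/\ convex_function (E := R^o) `[0, +oo[ (fun t => - w t),
      {in `[0, +oo[ &, {homo w : s t / s <= t}},
      w 0 = 0 &
      forall t, 0 < t -> 0 < w t].

Definition mendel_naor_constant (Delta : R) : Prop :=
  forall w : R -> R, concave_modulus w ->
  forall (d : measure_display) (T : measurableType d)
    (mu : {measure set T -> \bar R}),
    embeds_into_L1 (fun f g : LspaceType1 mu => w (L1dist f g)) Delta.

End Embeddings.

Section TwistedUnion.
Context {R : realType}.

(* [E u v a]: there is an undirected edge of weight [a] between [u] and [v]. *)
Inductive walk (V : Type) (E : V -> V -> R -> Prop) : V -> V -> R -> Prop :=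
| walk_nil u : walk E u u 0
| walk_cons u v z a l :
    E u v a \/ E v u a -> walk E v z l -> walk E u z (a + l).

Definition shortest_path (V : Type) (E : V -> V -> R -> Prop) (u v : V) : R :=
  inf [set l | walk E u v l].

Inductive twisted_edge (M : Type) (d0 d1 : M -> M -> R) (r : R) :
    M * 'F_2 -> M * 'F_2 -> R -> Prop :=
| twisted_edge0 x y : twisted_edge d0 d1 r (x, 0) (y, 0) (d0 x y)
| twisted_edge1 x y : twisted_edge d0 d1 r (x, 1) (y, 1) (d1 x y)
| twisted_edge_cross x : twisted_edge d0 d1 r (x, 0) (x, 1) r.

Definition twisted_union (M : Type) (d0 d1 : M -> M -> R) (r : R) :
    M * 'F_2 -> M * 'F_2 -> R :=
  shortest_path (twisted_edge d0 d1 r).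

End TwistedUnion.

(* Main.v *)
(* With m = min(w0, w1), which is again concave, the distances of the twisted
   union are w_i(|x - y|) on the level M x {i} and r + m(|x - y|) between (x, 0)
   and (y, 1).  A finite subset of L_1 is isometrically a nonnegative
   combination of cut metrics, so Mendel-Naor gives combinations rho_m, rho_0,
   rho_1 of cut metrics on M with w <= rho <= Delta w for w = m, w0, w1.
   Randomly forgetting cuts turns rho_i / 2r into a weighted family of subsets
   of M of which every point lies in total mass 1 and every pair x, y
   simultaneously in mass exp(- rho_i(x, y) / 2r).  Placing this family, with
   mass b r / 2, on the level i only, and adding rho_m, gives the combination
   of cut metrics rho_m + b r (1 - exp(- rho_i / 2r)) on the level i and
   rho_m + b r across; with b = 2 / (1 - 1/e) it dominates the twisted
   distance, with distortion at most max(Delta (1 + b / 2), b). *)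
Require Import Defs.
From HB Require Import structures.
From mathcomp Require Import all_boot all_order all_algebra.
From mathcomp Require Import all_classical all_reals all_analysis.
From mathcomp Require Import measurable_realfun ring lra.

Set Implicit Arguments.
Unset Strict Implicit.
Unset Printing Implicit Defensive.

Import Order.TTheory GRing.Theory Num.Theory.
Import numFieldNormedType.Exports.

Local Open Scope classical_set_scope.
Local Open Scope ring_scope.

(** * Representatives of classes in $L_1$ *)

Lemma Lspace_of d (T : measurableType d) (R : realType)
    (mu : {measure set T -> \bar R}) (f : T -> R) :
  f \in Lfun mu 1 -> exists F : LspaceType1 mu, ae_eq mu setT (F : T -> R) f.
Proof.
move=> fL.
have mf : measurable_fun setT (f : T -> measurableTypeR R).
  by move: fL; rewrite inE => /andP[/[!inE]].
pose g : {mfun T >-> measurableTypeR R} := HB.pack f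
  (isMeasurableFun.Build _ _ _ _ (f : T -> measurableTypeR R) mf).
pose q : {mfun_ mu, T >-> measurableTypeR R} :=
  \pi_({mfun_ mu, T >-> measurableTypeR R})%qT g.
(* The representative chosen by the quotient agrees with [f] only almost everywhere, which is enough
   for the norm to stay finite. *)
have qg : ae_eq mu setT (q : T -> R) f.
  have H : ae_eq_op mu (repr q) g.
    have: (repr q == g %[mod {mfun_ mu, T >-> measurableTypeR R}])%qT.
      by rewrite reprK.
    by rewrite eqmodE.
  exact: (asboolW H).
have fq : finite_norm mu 1 (q : T -> R).
  have fi : mu.-integrable setT (EFin \o f) by apply/Lfun1_integrable.
  rewrite /finite_norm Lnorm1.
  have qm : measurable_fun setT (q : T -> R).
    exact: (@measurable_funPT _ _ _ _ (repr q)).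
  rewrite (ae_eq_integral (fun x => `|(f x)%:E|)%E) //.
  - by case/integrableP: fi.
  - by apply/measurable_EFinP; exact: measurableT_comp.
  - by apply/measurable_EFinP; exact: measurableT_comp.
  - by apply: filterS qg => x /= + _ => ->.
pose F : LspaceType1 mu := HB.pack q
  (isFinLebesgue.Build _ _ _ _ _ (lexx 1%E) q fq).
by exists F.
Qed.

Lemma measurable_Lspace d (T : measurableType d) (R : realType)
    (mu : {measure set T -> \bar R}) (F : LspaceType1 mu) :
  measurable_fun setT (F : T -> R).
Proof.
exact: (@measurable_funPT _ _ _ _ (repr (F : {mfun_ mu, T >-> measurableTypeR R}))).
Qed.

Lemma ae_eq_L1dist d (T : measurableType d) (R : realType)
    (mu : {measure set T -> \bar R}) (F G : LspaceType1 mu) (f g : T -> R) :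
  measurable_fun setT f -> measurable_fun setT g ->
  ae_eq mu setT (F : T -> R) f -> ae_eq mu setT (G : T -> R) g ->
  L1dist F G = fine (\int[mu]_x `|f x - g x|%:E)%E.
Proof.
move=> mf mg Ff Gg.
rewrite /L1dist Lnorm1; congr fine.
have mF := measurable_Lspace F; have mG := measurable_Lspace G.
rewrite (ae_eq_integral (fun x => `|f x - g x|%:E)%E) //.
  - by apply/measurable_EFinP/measurableT_comp => //; exact: measurable_funB.
  - by apply/measurable_EFinP/measurableT_comp => //; exact: measurable_funB.
  - by apply: filterS2 Ff Gg => x /= + + _ => -> // ->.
Qed.

(** * Nonnegative combinations of cut metrics embed into $L_1$ *)

Definition cut_sum (R : realType) (X : Type) (s : seq (R * pred X)) (x y : X) : R :=
  \sum_(c <- s) c.1 * (c.2 x != c.2 y)%:R.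

Definition nonneg_weights (R : realType) (X : Type) (s : seq (R * pred X)) : bool :=
  all (fun c => 0 <= c.1) s.

Lemma integral_count_finite_support (R : realType) (n : nat) (a : nat -> R) :
  (forall k, (n <= k)%N -> a k = 0) ->
  (\int[counting]_k `|a k|%:E)%E = (\sum_(0 <= k < n) `|a k|)%:E.
Proof.
move=> a0; rewrite ge0_integral_count// (nneseries_split 0 n)//.
rewrite add0n eseries0 ?adde0 ?sumEFin// => k nk _.
by rewrite a0 ?normr0.
Qed.

(** Each cut becomes one coordinate of $\ell_1$, namely its weight times its indicator; two points
    differ there by the weight exactly when they are separated. *)
Lemma cut_sum_L1 (R : realType) (X : Type) (s : seq (R * pred X)) :
  nonneg_weights s ->
  exists (d : measure_display) (T : measurableType d)
    (mu : {measure set T -> \bar R}) (F : X -> LspaceType1 mu),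
    forall u v, L1dist (F u) (F v) = cut_sum s u v.
Proof.
(* The default cut has weight 0, so all coordinates from [size s] on vanish. *)
move=> s0; pose c k := nth (0, xpred0) s k.
pose a u k : R := (c k).1 * ((c k).2 u)%:R.
have a_supp u k : (size s <= k)%N -> a u k = 0.
  by move=> sk; rewrite /a /c nth_default// mul0r.
have aL u : a u \in Lfun counting 1.
  rewrite inE; apply/andP; split; first by rewrite inE.
  rewrite inE/= /finite_norm Lnorm1.
  by rewrite (integral_count_finite_support (a_supp u)) ltry.
exists _, nat, counting, (fun u => projT1 (cid (Lspace_of (aL u)))) => u v.
case: cid => F Fu; case: cid => G Gv /=.
rewrite (ae_eq_L1dist _ _ Fu Gv)//.
have auv_supp k : (size s <= k)%N -> a u k - a v k = 0.
  by move=> sk; rewrite !a_supp// subrr.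
rewrite (integral_count_finite_support auv_supp) /=.
rewrite /cut_sum (big_nth (0, xpred0)) !big_nat; apply: eq_bigr => k /andP[_ ks].
rewrite -mulrBr normrM ger0_norm; last first.
  by move/(all_nthP (0, xpred0)): s0 => /(_ _ ks).
rewrite /c; congr (_ * _).
by case: (nth _ s k).2; case: (nth _ s k).2;
  rewrite ?subrr ?normr0 ?subr0 ?sub0r ?normrN ?normr1.
Qed.

(** * Finite subsets of $L_1$ as combinations of cut metrics *)

Fixpoint bitseqs (n : nat) : seq bitseq :=
  if n is n'.+1 then
    [seq true :: b | b <- bitseqs n'] ++ [seq false :: b | b <- bitseqs n']
  else [:: [::]].

Lemma size_bitseqs n b : b \in bitseqs n -> size b = n.
Proof.
elim: n b => [|n IHn] b /=; first by rewrite inE => /eqP->.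
by rewrite mem_cat => /orP[] /mapP[b' /IHn <- ->].
Qed.

(* The length of the set of thresholds t in ]u, v] which are at most the entries
   of l flagged by b and greater than the other ones; 0 if b is too short. *)
Fixpoint slab (R : realType) (l : seq R) (b : bitseq) (u v : R) : R :=
  if l is a :: l' then
    if b is b0 :: b' then
      if b0 then slab l' b' u (Num.min v a) else slab l' b' (Num.max u a) v
    else 0
  else Num.max 0 (v - u).

Section Slab.
Context {R : realType}.
Implicit Types (l : seq R) (b : bitseq) (u v : R).

Lemma slab_ge0 l b u v : 0 <= slab l b u v.
Proof.
elim: l b u v => [|a l IHl] [|[] b] u v //=; by rewrite le_max lexx.
Qed.

Lemma slab_le l b u v : slab l b u v <= Num.max 0 (v - u).
Proof.
elim: l b u v => [|a l IHl] [|[] b] u v //=; try by rewrite le_max lexx.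
- apply: le_trans (IHl _ _ _) _.
  by rewrite le_max2 // lerB// ge_min lexx.
- apply: le_trans (IHl _ _ _) _.
  by rewrite le_max2 // lerB// le_max lexx.
Qed.

(** Every threshold in $]u,v]$ has exactly one pattern: the head [a] splits the interval into the
    thresholds at most [a] and those above it. *)
Lemma sum_slab l u v :
  \sum_(b <- bitseqs (size l)) slab l b u v = Num.max 0 (v - u).
Proof.
elim: l u v => [|a l IHl] u v /=; first by rewrite big_seq1.
rewrite big_cat !big_map /= !IHl.
by case: (leP v a) => ?; case: (leP u a) => ?; rewrite !maxEle;
  do ![case: ifPn; rewrite -?ltNge => ?]; lra.
Qed.

(** The recursion already truncates at every flagged entry, and [Num.min] is idempotent. *)
Lemma slab_true l b u v i : size b = size l -> (i < size l)%N ->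
  nth false b i -> slab l b u v = slab l b u (Num.min v (nth 0 l i)).
Proof.
elim: l b u v i => [|a l IHl] [|b0 b] u v [|i] //= [sb].
- by move=> _ ->; rewrite -minA minxx.
- rewrite ltnS => il bi; case: b0.
    by rewrite (IHl _ _ _ i)// minAC.
  by rewrite (IHl _ _ _ i).
Qed.

Lemma slab_false l b u v i : size b = size l -> (i < size l)%N ->
  ~~ nth false b i -> slab l b u v = slab l b (Num.max u (nth 0 l i)) v.
Proof.
elim: l b u v i => [|a l IHl] [|b0 b] u v [|i] //= [sb].
- by move=> _ /negbTE->; rewrite -maxA maxxx.
- rewrite ltnS => il bi; case: b0.
    by rewrite (IHl _ _ _ i).
  by rewrite (IHl _ _ _ i)// maxAC.
Qed.

(** Thresholds at most entry [i] and above entry [j] fill the interval from entry [j] to entry [i],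
    which the bounds [u] and [v] do not cut. Restricted to it, all other patterns have an empty
    slab, so [sum_slab] applies. *)
Lemma sum_slab_separated l u v i j : (i < size l)%N -> (j < size l)%N ->
  nth 0 l i <= v -> u <= nth 0 l j ->
  \sum_(b <- bitseqs (size l)) slab l b u v * (nth false b i && ~~ nth false b j)%:R
  = Num.max 0 (nth 0 l i - nth 0 l j).
Proof.
move=> il jl iv uj; rewrite -(sum_slab l); rewrite !big_seq.
apply: eq_bigr => b /size_bitseqs sb.
have slab0 u' v' : v' <= u' -> slab l b u' v' = 0.
  move=> vu; apply/le_anti; rewrite slab_ge0 (le_trans (slab_le _ _ _ _))//.
  by rewrite ge_max lexx subr_le0.
have [bi|bi] := boolP (nth false b i); last first.
  by rewrite mulr0 (slab_false _ _ sb il bi) slab0// le_max lexx orbT.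
have [bj|bj] := boolP (nth false b j).
  by rewrite mulr0 (slab_true _ _ sb jl bj) slab0// ge_min lexx orbT.
rewrite mulr1 (slab_true _ _ sb il bi) (slab_false _ _ sb jl bj).
by rewrite (min_idPr iv) (max_idPr uj).
Qed.

End Slab.

(** The bounds are functions, since the recursion replaces them by minima and maxima with the
    entries. *)
Lemma measurable_slab d (T : measurableType d) (R : realType)
    (fs : seq (T -> R)) (b : bitseq) (u v : T -> R) :
  (forall i, measurable_fun setT (nth (cst 0) fs i)) ->
  measurable_fun setT u -> measurable_fun setT v ->
  measurable_fun setT (fun t => slab [seq f t | f <- fs] b (u t) (v t)).
Proof.
elim: fs b u v => [|f fs IHfs] b u v mfs mu mv /=.
  by apply: (@measurable_maxr _ _ _ _ (cst 0) (v \- u)) => //; exact: measurable_funB.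
case: b => [|[] b]; first exact: measurable_cst.
- apply: IHfs => //; first by move=> i; exact: (mfs i.+1).
  by apply: measurable_minr => //; exact: (mfs 0).
- apply: IHfs => //; first by move=> i; exact: (mfs i.+1).
  by apply: measurable_maxr => //; exact: (mfs 0).
Qed.

Lemma integrable_Lspace d (T : measurableType d) (R : realType)
    (mu : {measure set T -> \bar R}) (F : LspaceType1 mu) :
  mu.-integrable setT (EFin \o (F : T -> R)).
Proof.
apply/Lfun1_integrable; rewrite inE; apply/andP; split; rewrite inE/=.
  exact: measurable_Lspace.
exact: Lebesgue_finite.
Qed.

Lemma normrB_max (R : realDomainType) (a b : R) :
  `|a - b| = Num.max 0 (a - b) + Num.max 0 (b - a).
Proof.
wlog ab : a b / a <= b => [H|].
  by case: (leP a b) => [/H//|/ltW/H ba]; rewrite distrC ba addrC.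
rewrite ler0_norm ?subr_le0// opprB max_l ?subr_le0//.
by rewrite max_r ?subr_ge0// add0r.
Qed.

(** At each [t], the distance between two values is the length of the set of thresholds separating
    them. Grouping thresholds by the subset of [xs] lying above them leaves finitely many cuts,
    weighted by the integrals of the slab lengths. *)
Lemma finite_L1_cut_sum d (T : measurableType d) (R : realType)
    (mu : {measure set T -> \bar R}) (X : eqType) (xs : seq X)
    (f : X -> LspaceType1 mu) :
  exists2 s, nonneg_weights s &
    {in xs &, forall x y, L1dist (f x) (f y) = cut_sum s x y}.
Proof.
pose g x : T -> R := f x.
(* An integrable bound for all the values at [t]: the interval from [- B t] to [B t] contains every
   separating threshold. *)
pose B t : R := \sum_(x <- xs) `|g x t|.
pose S b t : R := slab [seq g x t | x <- xs] b (- B t) (B t).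
have mg x : measurable_fun setT (g x) by exact: measurable_Lspace.
have Bi : mu.-integrable setT (EFin \o B).
  rewrite (_ : EFin \o B = fun t => \sum_(x <- xs) `|(g x t)%:E|)%E.
    apply: integrable_sum => // x _; apply: integrable_abse.
    exact: integrable_Lspace.
  by apply/funext => t; rewrite /= sumEFin.
have B0 t : 0 <= B t by apply: sumr_ge0.
have Si b : mu.-integrable setT (EFin \o S b).
  have := integrableZl measurableT 2 Bi.
  apply: le_integrable => //.
    apply/measurable_EFinP.
    rewrite (_ : S b =
      fun t => slab [seq h t | h <- map g xs] b (- B t) (B t)); last first.
      by apply/funext => t; rewrite -map_comp.
    have mB : measurable_fun setT B by case/integrableP: Bi => /measurable_EFinP.
    apply: measurable_slab => //; last exact: measurableT_comp.
    move=> i; have [ix|ix] := ltnP i (size (map g xs)); last first.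
      by rewrite nth_default//; exact: measurable_cst.
    case: xs {B Bi S B0 mB} i ix => [//|x xs] i ix.
    by rewrite (nth_map x)// -(size_map g).
  move=> t _ /=; rewrite lee_fin ger0_norm ?slab_ge0// ger0_norm ?mulr_ge0//.
  by rewrite (le_trans (slab_le _ _ _ _))// ge_max mulr_ge0// opprK; have := B0 t; lra.
pose c b : R * pred X :=
  (fine (\int[mu]_t (S b t)%:E)%E, fun x => nth false b (index x xs)).
have gB x t : x \in xs -> `|g x t| <= B t.
  by move=> xxs; rewrite /B (big_rem x)//= lerDl sumr_ge0.
exists [seq c b | b <- bitseqs (size xs)].
  rewrite /nonneg_weights all_map; apply/allP => b _ /=.
  by rewrite fine_ge0// integral_ge0// => t _; rewrite lee_fin slab_ge0.
move=> x y xxs yxs.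
(* The two positive parts of the difference count the patterns containing [x] but not [y], and [y]
   but not [x]. *)
have abs_slab t : `|g x t - g y t| =
    \sum_(b <- bitseqs (size xs)) ((c b).2 x != (c b).2 y)%:R * S b t.
  have nthg z : z \in xs -> nth 0 [seq g x t | x <- xs] (index z xs) = g z t.
    by move=> zxs; rewrite (nth_map z) ?index_mem// nth_index.
  have sep z z' : z \in xs -> z' \in xs -> Num.max 0 (g z t - g z' t) =
      \sum_(b <- bitseqs (size xs)) S b t * ((c b).2 z && ~~ (c b).2 z')%:R.
    move=> zxs z'xs.
    have := @sum_slab_separated _ [seq g x t | x <- xs] (- B t) (B t)
      (index z xs) (index z' xs).
    rewrite size_map !index_mem => /(_ zxs z'xs).
    rewrite !nthg// => ->//.
      by rewrite (le_trans _ (gB z _ _))// ler_norm.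
    by rewrite lerNl (le_trans _ (gB z' _ _))// -normrN ler_norm.
  rewrite normrB_max !sep// -big_split; apply: eq_bigr => b _ /=.
  by case: (nth _ _ _); case: (nth _ _ _) => /=;
    rewrite ?(mulr0, mulr1, mul0r, mul1r, addr0, add0r).
rewrite /L1dist Lnorm1.
transitivity (fine (\int[mu]_t \sum_(b <- bitseqs (size xs))
    (((c b).2 x != (c b).2 y)%:R%:E * (S b t)%:E))%E).
  congr fine; apply: eq_integral => t _.
  rewrite /= (abs_slab t).
  by rewrite -sumEFin; apply: eq_bigr => b _; rewrite EFinM.
rewrite integral_sum//; last by move=> b; exact: (integrableZl measurableT _ (Si b)).
rewrite /cut_sum big_map.
have intS b : (\int[mu]_t (((c b).2 x != (c b).2 y)%:R%:E * (S b t)%:E) =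
    ((c b).1 * ((c b).2 x != (c b).2 y)%:R)%:E)%E.
  rewrite mulrC EFinM (fineK (integrable_fin_num measurableT (Si b))).
  exact: (integralZl measurableT (Si b)).
rewrite -[RHS]/(fine (_%:E)) -sumEFin; congr fine.
by apply: eq_bigr => b _; exact: intS.
Qed.

(** * Operations on cut sums, and exponentials of cut sums *)

Definition pull_cuts (R : realType) (X Y : Type) (k : R) (h : Y -> X)
    (s : seq (R * pred X)) : seq (R * pred Y) :=
  [seq (k * c.1, fun y => c.2 (h y)) | c <- s].

Lemma nonneg_pull_cuts (R : realType) (X Y : Type) (k : R) (h : Y -> X)
    (s : seq (R * pred X)) :
  0 <= k -> nonneg_weights s -> nonneg_weights (pull_cuts k h s).
Proof.
move=> k0; rewrite /nonneg_weights all_map; apply: sub_all => c /=.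
exact: mulr_ge0.
Qed.

Lemma cut_sum_pull_cuts (R : realType) (X Y : Type) (k : R) (h : Y -> X)
    (s : seq (R * pred X)) (x y : Y) :
  cut_sum (pull_cuts k h s) x y = k * cut_sum s (h x) (h y).
Proof.
by rewrite /cut_sum big_map mulr_sumr; apply: eq_bigr => c _ /=; rewrite mulrA.
Qed.

Lemma cut_sum_cat (R : realType) (X : Type) (s1 s2 : seq (R * pred X)) (x y : X) :
  cut_sum (s1 ++ s2) x y = cut_sum s1 x y + cut_sum s2 x y.
Proof. exact: big_cat. Qed.

Lemma cut_sumxx (R : realType) (X : Type) (s : seq (R * pred X)) (x : X) :
  cut_sum s x x = 0.
Proof. by rewrite /cut_sum big1// => c _; rewrite eqxx mulr0. Qed.

Lemma cut_sumC (R : realType) (X : Type) (s : seq (R * pred X)) (x y : X) :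
  cut_sum s x y = cut_sum s y x.
Proof. by apply: eq_bigr => c _; rewrite eq_sym. Qed.

Lemma cut_sum_triangle (R : realType) (X : Type) (s : seq (R * pred X)) (x y z : X) :
  nonneg_weights s -> cut_sum s x z <= cut_sum s x y + cut_sum s y z.
Proof.
rewrite /cut_sum; elim: s => [|c s IHs] /=; first by rewrite !big_nil addr0.
move=> /andP[c0 /IHs IH]; rewrite !big_cons addrACA lerD// -mulrDr ler_wpM2l//.
by case: (c.2 x); case: (c.2 y); case: (c.2 z) => /=; lra.
Qed.

(* Here the predicates are sets and not cuts: a set is not equivalent to its
   complement. *)
Definition cover_mass (R : realType) (X : Type) (s : seq (R * pred X)) (x y : X) : R :=
  \sum_(c <- s) c.1 * (c.2 x && c.2 y)%:R.

(** This is $|A\triangle B|=|A|+|B|-2|A\cap B|$ for the weighted families $A$, $B$ of sets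
    containing [x] and [y]. *)
Lemma cut_sum_cover_mass (R : realType) (X : Type) (s : seq (R * pred X)) (x y : X) :
  cut_sum s x y = cover_mass s x x + cover_mass s y y - 2 * cover_mass s x y.
Proof.
rewrite /cut_sum /cover_mass mulr_sumr -big_split -sumrB; apply: eq_bigr => c _ /=.
by case: (c.2 x); case: (c.2 y) => /=; ring.
Qed.

(* Each cut of weight a is forgotten with probability exp(-a), independently;
   the remembered cuts form a random partition of X, two points of which lie in
   the same part when all the cuts separating them are forgotten. *)
Lemma expR_cut_sum (R : realType) (X : Type) (s : seq (R * pred X)) :
  nonneg_weights s ->
  exists2 s' : seq (R * pred X), nonneg_weights s' &
    forall x y, cover_mass s' x y = expR (- cut_sum s x y).
Proof.
elim: s => [_|[a P] s IHs /= /andP[a0 /IHs[s' s'0 Es']]].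
  exists [:: (1, fun=> true)]; first by rewrite /nonneg_weights /= ler01.
  by move=> x y; rewrite /cover_mass /cut_sum big_seq1 big_nil mulr1 oppr0 expR0.
pose e := expR (- a).
have e1 : 0 <= 1 - e by rewrite subr_ge0 /e expR_le1 oppr_le0.
(* With weight [e] the cut [P] is forgotten and a set stays whole; with weight [1 - e] it is split
   by [P] into two pieces. *)
exists ([seq (e * c.1, c.2) | c <- s'] ++
  [seq ((1 - e) * c.1, fun x => c.2 x && P x) | c <- s'] ++
  [seq ((1 - e) * c.1, fun x => c.2 x && ~~ P x) | c <- s']).
  rewrite /nonneg_weights !all_cat !all_map.
  by apply/and3P; split; apply: sub_all s'0 => c /= c0; rewrite mulr_ge0// expR_ge0.
move=> x y.
rewrite /cover_mass !big_cat !big_map /= -!big_split/=.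
transitivity ((if P x == P y then 1 else e) * cover_mass s' x y).
  rewrite /cover_mass mulr_sumr; apply: eq_bigr => c _.
  by case: (P x); case: (P y); case: (c.2 x); case: (c.2 y) => /=; ring.
rewrite Es' /cut_sum big_cons /= opprD expRD -/(cut_sum s x y).
by case: eqP => _; rewrite ?mulr0 ?mulr1 ?oppr0 ?expR0.
Qed.

(** * Lipschitz constants and distortion *)

Lemma Lip_attained (R : realType) (X Y : Type) (dX : X -> X -> R)
    (dY : Y -> Y -> R) (f : X -> Y) (C : R) :
  (forall u v, 0 <= dX u v) -> 0 <= C ->
  (forall u v, dY (f u) (f v) <= C * dX u v) ->
  exists L, [/\ 0 <= L, Lip dX dY f = L%:E &
    forall u v, dY (f u) (f v) <= L * dX u v].
Proof.
move=> dX0 C0 fC.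
set A := [set C : R | 0 <= C /\ forall u v, dY (f u) (f v) <= C * dX u v].
have AC : A C by [].
have lbA : has_lbound A by exists 0 => c [].
exists (inf A); split.
- by apply: lb_le_inf; [exists C|move=> c []].
- by rewrite /Lip ereal_inf_EFin//; exists C.
(* At distance 0 the known constant [C] gives the bound; elsewhere, dividing by [dX u v] gives a
   lower bound of all admissible constants. *)
- move=> u v; have [uv0|uv_gt0] := leP (dX u v) 0.
    have -> : dX u v = 0 by apply/le_anti; rewrite uv0 dX0.
    rewrite mulr0 (le_trans (fC u v))//.
    by rewrite mulr_ge0_le0.
  rewrite -ler_pdivrMr//; apply: lb_le_inf; first by exists C.
  by move=> c [c0 fc]; rewrite ler_pdivrMr.
Qed.

Lemma Lip_le (R : realType) (X Y : Type) (dX : X -> X -> R)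
    (dY : Y -> Y -> R) (f : X -> Y) (C : R) :
  0 <= C -> (forall u v, dY (f u) (f v) <= C * dX u v) ->
  (0 <= Lip dX dY f <= C%:E)%E.
Proof.
move=> C0 fC; apply/andP; split.
  by apply/ereal_infP => _ [c [c0 _]] <-; rewrite lee_fin.
by apply: ereal_inf_lbound; exists C.
Qed.

Lemma range_invK (X Y : Type) (F : X -> Y) (y : range F) :
  F (range_inv y) = set_val y.
Proof. by rewrite /range_inv; case: cid2. Qed.

(** With [k] the Lipschitz constant of the inverse, the rescaled map does not contract, and its
    Lipschitz constant is the distortion. *)
Lemma distortion_rescale (R : realType) (X Y : Type) (dX : X -> X -> R)
    (dY : Y -> Y -> R) (F : X -> Y) (D : R) :
  (forall u v, 0 <= dX u v) -> (forall u v, 0 <= dY u v) ->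
  bilipschitz_embedding dX dY F -> (distortion dX dY F <= D%:E)%E ->
  exists2 k, 0 <= k &
    forall u v, dX u v <= k * dY (F u) (F v) <= D * dX u v.
Proof.
move=> dX0 dY0 [Finj [C1 [C2 [C1_gt0 C2_gt0 FC]]]].
have [L [L0 LE FL]] : exists L, [/\ 0 <= L, Lip dX dY F = L%:E &
    forall u v, dY (F u) (F v) <= L * dX u v].
  apply: (@Lip_attained _ _ _ _ _ _ C2) => //; first exact: ltW.
  by move=> u v; case/andP: (FC u v).
have [K [K0 KE FK]] : exists K, [/\ 0 <= K,
    Lip (fun y z : range F => dY (set_val y) (set_val z)) dX (@range_inv X Y F)
      = K%:E &
    forall y z : range F, dX (range_inv y) (range_inv z)
      <= K * dY (set_val y) (set_val z)].
  apply: (@Lip_attained _ _ _ _ _ _ C1^-1) => //; first by rewrite invr_ge0 ltW.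
  move=> y z; rewrite -(range_invK y) -(range_invK z) ler_pdivlMl//.
  by case/andP: (FC (range_inv y) (range_inv z)).
rewrite /distortion LE KE -EFinM lee_fin => LKD.
exists K => // u v; apply/andP; split.
  pose y w : range F := SigSub (mem_set (imageP F (I : setT w))).
  have yK w : range_inv (y w) = w by apply: Finj; rewrite range_invK.
  by have := FK (y u) (y v); rewrite !yK.
rewrite (le_trans _ (ler_wpM2r (dX0 u v) LKD))//.
by rewrite [leRHS]mulrAC [leRHS]mulrC ler_wpM2l.
Qed.

Lemma distortion_le (R : realType) (X Y : Type) (dX : X -> X -> R)
    (dY : Y -> Y -> R) (F : X -> Y) (D : R) : 0 <= D ->
  (forall u v, dX u v <= dY (F u) (F v) <= D * dX u v) ->
  (distortion dX dY F <= D%:E)%E.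
Proof.
move=> D0 FD; rewrite /distortion -[leRHS]mule1.
have /andP[L0 LD] := @Lip_le _ _ _ dX dY F D D0 (fun u v => proj2 (andP (FD u v))).
have /andP[K0 K1] : (0 <= Lip (fun y z : range F => dY (set_val y) (set_val z))
    dX (@range_inv X Y F) <= 1%:E)%E.
  apply: Lip_le => // y z; rewrite mul1r -(range_invK y) -(range_invK z).
  by case/andP: (FD (range_inv y) (range_inv z)).
exact: lee_pmul.
Qed.

(** * Positivity and separation for the $L_1$ distance *)

Lemma L1dist_ge0 d (T : measurableType d) (R : realType)
    (mu : {measure set T -> \bar R}) (F G : LspaceType1 mu) : 0 <= L1dist F G.
Proof. by rewrite fine_ge0// Lnorm_ge0. Qed.

Lemma L1dist_eq0 d (T : measurableType d) (R : realType)
    (mu : {measure set T -> \bar R}) (F G : LspaceType1 mu) :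
  L1dist F G = 0 -> F = G.
Proof.
move=> FG0.
have FGi : mu.-integrable setT (EFin \o (fun x => F x - G x)).
  have := integrableB measurableT (integrable_Lspace F) (integrable_Lspace G).
  by [].
have FG : ae_eq mu setT (F : T -> R) (G : T -> R).
  have mFG : measurable_fun setT (EFin \o (fun x => F x - G x)).
    by case/integrableP: FGi.
  have : ('N[mu]_1[EFin \o (fun x => (F x - G x)%R)] = 0)%E.
    apply/eqP; rewrite -fine_eq0; first exact/eqP.
    by rewrite Lnorm1 ge0_fin_numE ?integral_ge0//; case/integrableP: FGi.
  move=> /(Lnorm_eq0_eq0 mFG) => /(_ lte01).
  by apply: filterS => x + _ => /(_ I) /= [] /subr0_eq.
have : (F : {mfun_ mu, T >-> measurableTypeR R}) = G.
  rewrite -[LHS]reprK -[RHS]reprK; apply/eqP; rewrite eqmodE.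
  exact/asboolP.
(* Once the classes agree, the two structures differ only by the proof that the norm is finite. *)
case: F G {FG0 FGi FG} => [F [[Fp]]] [G [[Gp]]] /= FG.
by case: _ / FG in Gp *; rewrite (Prop_irrelevance Fp Gp).
Qed.

(** * Concave moduli *)

Section ConcaveModulus.
Context {R : realType}.
Implicit Types w : R -> R.

Lemma concave_modulus_ge0 w t : concave_modulus w -> 0 <= t -> 0 <= w t.
Proof.
by case=> _ _ w0 w_gt0; rewrite le_eqVlt => /predU1P[<-|/w_gt0/ltW//]; rewrite w0.
Qed.

(** Concavity between 0 and [s + t] gives $w(s)\ge\frac{s}{s+t}w(s+t)$ and likewise for [t]; the two
    bounds add up. *)
Lemma concave_modulus_subadd w s t : concave_modulus w -> 0 <= s -> 0 <= t ->
  w (s + t) <= w s + w t.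
Proof.
move=> [cw _ w0 _].
have sub1 s' t' : 0 <= s' -> 0 < t' -> s' / (s' + t') * w (s' + t') <= w s'.
  move=> s0 t0; have st0 : 0 < s' + t' by rewrite ltr_wpDl.
  have p0 : 0 <= s' / (s' + t') by rewrite divr_ge0 // ltW.
  have p1 : s' / (s' + t') <= 1 by rewrite ler_pdivrMr// mul1r lerDl ltW.
  have in0 (x : R) : 0 <= x -> (x : R^o) \in [set` `[0, +oo[ : interval R].
    by move=> x0; rewrite inE /= in_itv /= x0.
  pose p := s' / (s' + t').
  have : - w (p * (s' + t') + (1 - p) * 0)
      <= p * - w (s' + t') + (1 - p) * - w 0.
    exact: (cw (Itv01 p0 p1) _ _ (in0 _ (ltW st0)) (in0 0 (lexx 0))).
  rewrite mulr0 addr0 w0 oppr0 mulr0 addr0 mulrN lerN2.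
  by rewrite divfK// gt_eqF.
rewrite le_eqVlt => /predU1P[<-|s0]; first by rewrite !add0r w0 add0r.
rewrite le_eqVlt => /predU1P[<-|t0]; first by rewrite !addr0 w0 addr0.
have := sub1 t s (ltW t0) s0; have := sub1 s t (ltW s0) t0.
rewrite (addrC t s) => h1 h2; apply: le_trans (lerD h1 h2).
rewrite -mulrDl -mulrDl divff ?mul1r//.
by rewrite gt_eqF// addr_gt0.
Qed.

Lemma concave_modulus_min w0 w1 : concave_modulus w0 -> concave_modulus w1 ->
  concave_modulus (fun t => Num.min (w0 t) (w1 t)).
Proof.
move=> [c0 h0 z0 p0] [c1 h1 z1 p1]; split.
- move=> t x y xD yD.
  have := c0 t x y xD yD; have := c1 t x y xD yD.
  rewrite !convRE /= !oppr_min => k1 k0.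
  have t0 : 0 <= t%:num :> R by [].
  have t1 : 0 <= 1 - t%:num :> R by rewrite subr_ge0.
  rewrite ge_max; apply/andP; split.
    by apply: (le_trans k0); rewrite lerD// ler_wpM2l// le_max lexx.
  by apply: (le_trans k1); rewrite lerD// ler_wpM2l// le_max lexx orbT.
- by move=> s t sD tD st; rewrite le_min2// ?h0// h1.
- by rewrite z0 z1 minxx.
- by move=> t t0; rewrite lt_min p0// p1.
Qed.

Lemma concave_modulus_id : concave_modulus (@id R).
Proof.
split=> //; move=> t x y _ _ /=.
by rewrite !convRE /= opprD !mulrN.
Qed.

End ConcaveModulus.

(** * Closed form of the twisted union metric *)

Section TwistedDistance.
Context {R : realType} {M : Type} (d0 d1 : M -> M -> R) (r : R).

Definition twisted_dist (p q : M * 'F_2) : R :=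
  if p.2 == q.2 then (if p.2 == 0 then d0 else d1) p.1 q.1
  else r + Num.min (d0 p.1 q.1) (d1 p.1 q.1).

Lemma F2_cases (i : 'F_2) : i = 0 \/ i = 1.
Proof. by case: i => [[|[|//]] i2]; [left|right]; apply: val_inj. Qed.

Hypotheses (d0xx : forall x, d0 x x = 0) (d1xx : forall x, d1 x x = 0).
Hypotheses (d0C : forall x y, d0 x y = d0 y x) (d1C : forall x y, d1 x y = d1 y x).
Hypothesis d0_triangle : forall x y z, d0 x z <= d0 x y + d0 y z.
Hypothesis d1_triangle : forall x y z, d1 x z <= d1 x y + d1 y z.
Hypothesis min_triangle : forall x y z, Num.min (d0 x z) (d1 x z) <=
  Num.min (d0 x y) (d1 x y) + Num.min (d0 y z) (d1 y z).
Hypothesis d01 : forall x y, `|d0 x y - d1 x y| <= 2 * r.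

Let d_le x y : d0 x y <= d1 x y + 2 * r /\ d1 x y <= d0 x y + 2 * r.
Proof. by have := d01 x y; rewrite ler_norml => /andP[]; split; lra. Qed.

(** The distance to [p] acts as a potential that varies by at most the weight along any edge, in
    both directions; summing along a walk bounds its length from below. *)
Lemma twisted_edge_dist u v p a : twisted_edge d0 d1 r u v a ->
  twisted_dist u p <= a + twisted_dist v p /\
  twisted_dist v p <= a + twisted_dist u p.
Proof.
have oneq0 : (1 == 0 :> 'F_2) = false by [].
have zeq1 : (0 == 1 :> 'F_2) = false by [].
have min_ge x y z :
    Num.min (d0 x z) (d1 x z) <= d0 x y + Num.min (d0 y z) (d1 y z) /\
    Num.min (d0 x z) (d1 x z) <= d1 x y + Num.min (d0 y z) (d1 y z).
  have := min_triangle x y z.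
  have : Num.min (d0 x y) (d1 x y) <= d0 x y by rewrite ge_min lexx.
  have : Num.min (d0 x y) (d1 x y) <= d1 x y by rewrite ge_min lexx orbT.
  lra.
case: p => z k; case=> [x y|x y|x]; rewrite /twisted_dist /=.
- have := d0_triangle x y z; have := d0_triangle y x z.
  have [] := min_ge x y z; have [] := min_ge y x z; rewrite (d0C y x).
  by case: (F2_cases k) => ->; rewrite ?eqxx ?zeq1 => *; split; lra.
- have := d1_triangle x y z; have := d1_triangle y x z.
  have [] := min_ge x y z; have [] := min_ge y x z; rewrite (d1C y x).
  by case: (F2_cases k) => ->; rewrite ?eqxx ?oneq0 => *; split; lra.
(* For a crossing edge, the worst case compares $d_i(x,z)$ with $2r+\min(d_0,d_1)(x,z)$, which is
   the closeness of the two metrics. *)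
- have [] := d_le x z.
  have : Num.min (d0 x z) (d1 x z) <= d0 x z by rewrite ge_min lexx.
  have : Num.min (d0 x z) (d1 x z) <= d1 x z by rewrite ge_min lexx orbT.
  case: (F2_cases k) => ->; rewrite ?eqxx ?oneq0 ?zeq1 minEle;
    by case: ifP => *; split; lra.
Qed.

Lemma twisted_distxx p : twisted_dist p p = 0.
Proof. by rewrite /twisted_dist eqxx; case: ifP. Qed.

Lemma twisted_dist_le_walk p q l :
  walk (twisted_edge d0 d1 r) p q l -> twisted_dist p q <= l.
Proof.
elim=> [u|u v z a b uv _ IH]; first by rewrite twisted_distxx.
have : twisted_dist u z <= a + twisted_dist v z.
  by case: uv => /(twisted_edge_dist z)[].
by lra.
Qed.

Lemma twisted_dist_walk p q :
  walk (twisted_edge d0 d1 r) p q (twisted_dist p q).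
Proof.
have one x y i : walk (twisted_edge d0 d1 r) (x, i) (y, i)
    ((if i == 0 then d0 else d1) x y).
  rewrite -[X in walk _ _ _ X]addr0; apply: walk_cons (walk_nil _ _); left.
  by case: (F2_cases i) => ->; rewrite /=; constructor.
have cross x i j : i != j ->
    twisted_edge d0 d1 r (x, i) (x, j) r \/ twisted_edge d0 d1 r (x, j) (x, i) r.
  by case: (F2_cases i) (F2_cases j) => -> [] -> // _; [left|right]; constructor.
case: p q => x i [y j]; rewrite /twisted_dist /=.
have [->|ij] := eqVneq i j; first exact: one.
(* [k] is the level on which the walk goes from [x] to [y]: it crosses first if [k] is the final
   level, and last otherwise. *)
have step (k : 'F_2) : walk (twisted_edge d0 d1 r) (x, i) (y, j)
    (r + (if k == 0 then d0 else d1) x y).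
  have [->|kj] := eqVneq k j; first exact: walk_cons (cross x i j ij) (one x y j).
  have -> : k = i.
    by move: ij kj; case: (F2_cases i) (F2_cases j) (F2_cases k) => -> [] -> [] ->.
  rewrite addrC; apply: (@walk_cons _ _ _ _ (y, i)).
    by left; case: (F2_cases i) => ->; constructor.
  rewrite -[X in walk _ _ _ X]addr0.
  exact: walk_cons (cross y i j ij) (walk_nil _ _).
by case: leP => _; [exact: (step 0)|exact: (step 1)].
Qed.

Lemma twisted_unionE p q : twisted_union d0 d1 r p q = twisted_dist p q.
Proof.
have lb : lbound [set l | walk (twisted_edge d0 d1 r) p q l] (twisted_dist p q).
  by move=> l; exact: twisted_dist_le_walk.
apply/le_anti/andP; split.
  by apply: ge_inf; [exists (twisted_dist p q)|exact: twisted_dist_walk].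
by apply: lb_le_inf => //; exists (twisted_dist p q); exact: twisted_dist_walk.
Qed.

End TwistedDistance.

(** * Numerical estimates *)

Section Numerics.
Context {R : realType}.

Lemma expR_partial_sum (x : R) (n : nat) : 0 <= x ->
  \sum_(0 <= k < n) x ^+ k / k`!%:R <= expR x.
Proof.
move=> x0; rewrite /expR.
have := @nondecreasing_cvgn_le R (series (exp_coeff x)) _ (is_cvg_series_exp_coeff x) n.
apply; apply: nondecreasing_series => k _ _.
by rewrite divr_ge0// exprn_ge0.
Qed.

Lemma expR1_gt : 2718 / 1000 < expR 1 :> R.
Proof.
(* The first seven terms add up to $1957/720>2.718$. *)
apply: lt_le_trans (@expR_partial_sum 1 7 ler01).
rewrite !big_nat_recr//= big_geq//= !expr1n !factS fact0 !muln1.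
by lra.
Qed.

Lemma expRN1_lt : expR (-1) < 2 / 5 :> R.
Proof.
rewrite expRN invf_plt ?posrE ?expR_gt0//.
by apply: lt_trans expR1_gt; lra.
Qed.

(** The concave function $1-e^{-x}$ lies above its chord on $[0,1]$. *)
Lemma onem_expRN_ge_chord (x : R) : 0 <= x -> x <= 1 ->
  x * (1 - expR (-1)) <= 1 - expR (- x).
Proof.
move=> x0 x1.
have : expR (x * -1 + (1 - x) * 0) <= x * expR (-1) + (1 - x) * expR 0.
  exact: (convex_expR (Itv01 x0 x1) (-1 : R^o) (0 : R^o)).
by rewrite mulr0 addr0 mulrN1 expR0; lra.
Qed.

Lemma distortion_bound_lt (Delta : R) :
  Delta <= (2 * Num.sqrt 2 + 3) * expR 1 / (expR 1 - 1) ->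
  1 + 2776 / 1000 * Delta < 266 / 10.
Proof.
have e2 := expR1_gt.
have s0 : 0 <= Num.sqrt 2 :> R by rewrite sqrtr_ge0.
have sE : Num.sqrt 2 * Num.sqrt 2 = 2 :> R by rewrite -expr2 sqr_sqrtr.
move: s0 sE; set s := Num.sqrt 2 => s0 sE.
(* A continued fraction convergent of $\sqrt2$ from above; $577^2=2\cdot408^2+1$. *)
have s2 : s < 577 / 408 by nra.
set e := expR 1 in e2 *.
have e10 : 0 < e - 1 by lra.
(* The margin is narrow: $1291/140$ lies just below $25.6/2.776$. *)
move=> De; suff : (2 * s + 3) * e / (e - 1) < 1291 / 140 by move: De; lra.
rewrite ltr_pdivrMr//.
have : (2 * s + 3) * e <= 1189 / 204 * e by rewrite ler_wpM2r; lra.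
by lra.
Qed.

(* Chosen so that cross_scale * r * (1 - exp(- x / 2r)) reaches 2r at x = 2r. *)
Definition cross_scale : R := 2 / (1 - expR (-1)).
Local Notation beta := cross_scale.

(** If [rho] is at most $2r$, the chord estimate makes the exponential term at least [rho], hence at
    least [w]; otherwise this term is at least $2r$, and [rho_m] supplies the missing [m]. *)
Lemma level_lower_bound (r m w rho_m rho : R) : 0 < r -> 0 <= w ->
  0 <= m -> w <= m + 2 * r -> m <= rho_m -> w <= rho ->
  w <= rho_m + beta * r * (1 - expR (- ((2 * r)^-1 * rho))).
Proof.
move=> r0 w0 m0 wm mrho wrho.
have E1 := expRN1_lt.
have c0 : 0 < 1 - expR (-1) :> R by lra.
have r20 : 0 < 2 * r by rewrite mulr_gt0.
set x := (2 * r)^-1 * rho.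
have rho0 : 0 <= rho by exact: le_trans w0 wrho.
have x0 : 0 <= x by rewrite mulr_ge0// invr_ge0 ltW.
have rhoE : rho = 2 * r * x by rewrite /x mulVKf ?lt0r_neq0.
have bE y : beta * r * y = 2 * r * (y / (1 - expR (-1))).
  by rewrite /cross_scale; field; rewrite gt_eqF.
rewrite bE.
have [x1|x1] := leP x 1.
  have : 2 * r * x <= 2 * r * ((1 - expR (- x)) / (1 - expR (-1))).
    by rewrite ler_wpM2l ?(ltW r20)// ler_pdivlMr// onem_expRN_ge_chord.
  lra.
have : 2 * r * 1 <= 2 * r * ((1 - expR (- x)) / (1 - expR (-1))).
  by rewrite ler_wpM2l ?(ltW r20)// ler_pdivlMr// mul1r lerB// ler_expR lerN2 ltW.
lra.
Qed.

(** From $1-e^{-x}\le x$ the exponential term is at most [beta / 2 * rho]. As $e^{-1}<2/5$ gives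
    $\beta\le10/3$, the total is at most $(1+5/3)\Delta w$, and $8/3<2.776$. *)
Lemma level_upper_bound (Delta r m w rho_m rho : R) : 0 < r -> 1 <= Delta ->
  0 <= w -> m <= w -> rho_m <= Delta * m -> rho <= Delta * w ->
  rho_m + beta * r * (1 - expR (- ((2 * r)^-1 * rho)))
    <= (1 + 2776 / 1000 * Delta) * w.
Proof.
move=> r0 D1 w0 mw rhom rhow.
have E1 := expRN1_lt.
have c0 : 0 < 1 - expR (-1) :> R by lra.
have b0 : 0 <= beta by rewrite divr_ge0 // ltW.
have b1 : beta <= 10 / 3 by rewrite ler_pdivrMr//; lra.
have Dmw : Delta * m <= Delta * w by rewrite ler_wpM2l//; lra.
have : beta * r * (1 - expR (- ((2 * r)^-1 * rho))) <= beta * r * ((2 * r)^-1 * rho).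
  rewrite ler_wpM2l ?mulr_ge0 ?(ltW r0)//.
  by have := expR_ge1Dx (- ((2 * r)^-1 * rho)); lra.
have -> : beta * r * ((2 * r)^-1 * rho) = beta / 2 * rho by field; rewrite gt_eqF.
have : beta / 2 * rho <= 5 / 3 * (Delta * w).
  apply: (@le_trans _ _ (beta / 2 * (Delta * w))).
    by rewrite ler_wpM2l// divr_ge0.
  by rewrite ler_wpM2r ?mulr_ge0//; lra.
by nra.
Qed.

(** The coefficient of [r] is at most $10/3<3.776$, which [1 <= Delta] turns into the required
    bound. *)
Lemma cross_upper_bound (Delta r m rho_m : R) : 0 < r -> 1 <= Delta ->
  0 <= m -> rho_m <= Delta * m ->
  rho_m + beta * r <= (1 + 2776 / 1000 * Delta) * (r + m).
Proof.
move=> r0 D1 m0 rhom.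
have E1 := expRN1_lt.
have c0 : 0 < 1 - expR (-1) :> R by lra.
have b1 : beta <= 10 / 3 by rewrite ler_pdivrMr//; lra.
have : beta * r <= (1 + 2776 / 1000 * Delta) * r by rewrite ler_wpM2r ?ltW//; lra.
by nra.
Qed.

Lemma cross_scale_ge1 : 1 <= beta.
Proof.
have E1 := expRN1_lt; have E0 := expR_gt0 (-1 : R).
by rewrite ler_pdivlMr; lra.
Qed.

End Numerics.

(** * Cut sums given by the Mendel-Naor constant *)

Lemma finite_subset_L1_cut_sum d (T : measurableType d) (R : realType)
    (mu : {measure set T -> \bar R}) (X : Type) (M : set X)
    (f : X -> LspaceType1 mu) :
  finite_set M ->
  exists2 s : seq (R * pred M), nonneg_weights s &
    forall x y : M, L1dist (f (set_val x)) (f (set_val y)) = cut_sum s x y.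
Proof.
move=> finM.
(* [{classic X}] equips [X] with the decidable equality that listing points by [index] requires. *)
have [xs Mxs] : exists xs : seq {classic X}, (M : set {classic X}) = [set` xs].
  exact/finite_seqP.
have inM (x : {classic X}) : M x -> x \in xs by rewrite (_ : M x = [set` xs] x)// -Mxs.
have inxs (x : M) : (set_val x : {classic X}) \in xs by apply: inM; exact: set_valP.
have [s s0 sE] := @finite_L1_cut_sum _ _ _ mu {classic X} xs f.
exists (pull_cuts 1 set_val s); first exact: nonneg_pull_cuts.
by move=> x y; rewrite cut_sum_pull_cuts mul1r sE.
Qed.

(** The Mendel-Naor embedding sends [M] to finitely many points of another $L_1$ space; their cut
    sum is rescaled so that it dominates the original distance. *)
Lemma modulus_cut_sum d (T : measurableType d) (R : realType)
    (mu : {measure set T -> \bar R}) (Delta : R) (w : R -> R)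
    (M : set (LspaceType1 mu)) :
  mendel_naor_constant Delta -> concave_modulus w -> finite_set M ->
  exists2 s : seq (R * pred M), nonneg_weights s &
    forall x y : M, w (L1dist (set_val x) (set_val y)) <= cut_sum s x y
      <= Delta * w (L1dist (set_val x) (set_val y)).
Proof.
move=> DMN wc finM.
have [d' [T' [mu' [F [Fbil Fdist]]]]] := DMN w wc d T mu.
have [||k k0 kF] := distortion_rescale _ _ Fbil Fdist.
- by move=> u v; exact: concave_modulus_ge0 (L1dist_ge0 _ _).
- by move=> u v; exact: L1dist_ge0.
have [s s0 sE] := finite_subset_L1_cut_sum F finM.
exists (pull_cuts k id s); first exact: nonneg_pull_cuts.
by move=> x y; rewrite cut_sum_pull_cuts -sE.
Qed.

(** No embedding of two points at distance 1 has distortion below 1. Constants under a Dirac mass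
    provide such points, with the identity as modulus. *)
Lemma mendel_naor_constant_ge1 (R : realType) (Delta : R) :
  mendel_naor_constant Delta -> 1 <= Delta.
Proof.
move=> DMN.
pose nu : {finite_measure set nat -> \bar R} := \d_0%N.
have [F0 F00] := Lspace_of (Lfun_cst nu 0 1).
have [F1 F11] := Lspace_of (Lfun_cst nu 1 1).
have F01 : L1dist F1 F0 = 1.
  rewrite (ae_eq_L1dist _ _ F11 F00)//.
  by rewrite integral_dirac//= indicE in_setT mul1r subr0 normr1.
have [d' [T' [mu' [F [Fbil Fdist]]]]] := DMN _ concave_modulus_id _ _ nu.
have [||k k0 kF] := distortion_rescale _ _ Fbil Fdist;
  try by move=> *; exact: L1dist_ge0.
by have /andP[a b] := kF F1 F0; move: (le_trans a b); rewrite F01 mulr1.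
Qed.

(** * Cuts on the twisted union *)

Section TwistedCuts.
Context {R : realType} {M : Type}.

Definition side_cuts (k : R) (i : 'F_2) (s : seq (R * pred M)) :
    seq (R * pred (M * 'F_2)) :=
  [seq (k * c.1, fun p => (p.2 == i) && c.2 p.1) | c <- s].

Lemma nonneg_side_cuts k i s : 0 <= k -> nonneg_weights s ->
  nonneg_weights (side_cuts k i s).
Proof.
move=> k0; rewrite /nonneg_weights all_map; apply: sub_all => c /=.
exact: mulr_ge0.
Qed.

Lemma cover_mass_side_cuts k i s (p q : M * 'F_2) :
  cover_mass (side_cuts k i s) p q =
  ((p.2 == i) && (q.2 == i))%:R * (k * cover_mass s p.1 q.1).
Proof.
rewrite /cover_mass big_map !mulr_sumr; apply: eq_bigr => c _ /=.
by case: (p.2 == i); case: (q.2 == i) => /=;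
  rewrite ?andbF ?(mul0r, mulr0, mul1r, mulrA).
Qed.

End TwistedCuts.

Lemma cut_sum_same_side (R : realType) (M : Type) (k : R) (i j : 'F_2)
    (s : seq (R * pred M)) (x y : M) :
  cut_sum (side_cuts k i s) (x, j) (y, j) = (i == j)%:R * (k * cut_sum s x y).
Proof.
rewrite !cut_sum_cover_mass !cover_mass_side_cuts /= andbb (eq_sym j).
by case: (i == j) => /=; ring.
Qed.

(** No set of the family meets both levels, so every set containing one of the two points separates
    them. *)
Lemma cut_sum_cross_side (R : realType) (M : Type) (k : R) (i j l : 'F_2)
    (s : seq (R * pred M)) (x y : M) : j != l ->
  cut_sum (side_cuts k i s) (x, j) (y, l) =
  k * ((j == i)%:R * cover_mass s x x + (l == i)%:R * cover_mass s y y).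
Proof.
move=> jl; rewrite !cut_sum_cover_mass !cover_mass_side_cuts /= !andbb.
have -> : (j == i) && (l == i) = false.
  by apply/negP => /andP[/eqP ji /eqP li]; move: jl; rewrite ji li eqxx.
by rewrite mul0r mulr0 subr0 mulrDr !mulrA !(mulrC k).
Qed.

Lemma twisted_union_cut_sum (R : realType) (Delta r : R) (M : Type)
    (n : M -> M -> R) (w0 w1 : R -> R)
    (sm s0 s1 : seq (R * pred M)) :
  let m t := Num.min (w0 t) (w1 t) in
  0 < r -> 1 <= Delta ->
  (forall t, 0 <= t -> `|w0 t - w1 t| <= 2 * r) ->
  (forall t, 0 <= t -> 0 <= w0 t) -> (forall t, 0 <= t -> 0 <= w1 t) ->
  (forall x y, 0 <= n x y) ->
  nonneg_weights sm -> nonneg_weights s0 -> nonneg_weights s1 ->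
  (forall x y, m (n x y) <= cut_sum sm x y <= Delta * m (n x y)) ->
  (forall x y, w0 (n x y) <= cut_sum s0 x y <= Delta * w0 (n x y)) ->
  (forall x y, w1 (n x y) <= cut_sum s1 x y <= Delta * w1 (n x y)) ->
  exists2 s : seq (R * pred (M * 'F_2)), nonneg_weights s &
    forall p q, let tau := twisted_dist (fun x y => w0 (n x y))
                            (fun x y => w1 (n x y)) r p q in
    tau <= cut_sum s p q <= (1 + 2776 / 1000 * Delta) * tau.
Proof.
move=> m r0 D1 w01 w0_ge0 w1_ge0 n0 sm0 s00 s10 smE s0E s1E.
have r20 : 0 <= (2 * r)^-1 by rewrite invr_ge0 mulr_ge0// ltW.
have [t0 t00 t0E] := expR_cut_sum (nonneg_pull_cuts id r20 s00).
have [t1 t10 t1E] := expR_cut_sum (nonneg_pull_cuts id r20 s10).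
pose beta := @cross_scale R.
(* Half of [beta * r], because a pair across the levels is separated by the full mass 1 of both
   families. *)
pose k := beta * r / 2.
have k0 : 0 <= k.
  rewrite divr_ge0// mulr_ge0 ?(ltW r0)//.
  by have := @cross_scale_ge1 R; rewrite -/beta; lra.
exists (pull_cuts 1 fst sm ++ side_cuts k 0 t0 ++ side_cuts k 1 t1).
  rewrite /nonneg_weights !all_cat; apply/and3P; split.
  - exact: nonneg_pull_cuts.
  - exact: nonneg_side_cuts.
  - exact: nonneg_side_cuts.
(* Each point has cover mass $e^0=1$, whence the two summands 1 and the factor 2. *)
have level x y :
    cut_sum t0 x y = 2 * (1 - expR (- ((2 * r)^-1 * cut_sum s0 x y))) /\
    cut_sum t1 x y = 2 * (1 - expR (- ((2 * r)^-1 * cut_sum s1 x y))).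
  split; rewrite cut_sum_cover_mass ?t0E ?t1E !cut_sum_pull_cuts !cut_sumxx
    mulr0 oppr0 expR0; ring.
have m_ge0 x y : 0 <= m (n x y) by rewrite le_min w0_ge0// w1_ge0.
have m0 t : m t <= w0 t by rewrite ge_min lexx.
have m1 t : m t <= w1 t by rewrite ge_min lexx orbT.
have w0m t : 0 <= t -> w0 t <= m t + 2 * r.
  by move=> /w01; rewrite ler_norml /m minEle => /andP[]; case: ifP; lra.
have w1m t : 0 <= t -> w1 t <= m t + 2 * r.
  by move=> /w01; rewrite ler_norml /m minEle => /andP[]; case: ifPn;
    rewrite -?ltNge; lra.
have kE z : k * (2 * z) = beta * r * z by rewrite /k; field.
move=> [x i] [y j]; rewrite /twisted_dist /=.
have /andP[mlo mhi] := smE x y.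
rewrite !cut_sum_cat cut_sum_pull_cuts mul1r /=.
have [<-|ij] := eqVneq i j.
  rewrite !cut_sum_same_side; have [-> ->] := level x y; rewrite !kE.
  case: (F2_cases i) => -> /=; rewrite ?mul0r ?mul1r ?addr0 ?add0r.
    have /andP[lo hi] := s0E x y; apply/andP; split.
      exact: (level_lower_bound r0 (w0_ge0 _ _) (m_ge0 x y) (w0m _ _) mlo lo).
    exact: (level_upper_bound r0 D1 (w0_ge0 _ _) (m0 _) mhi hi).
  have /andP[lo hi] := s1E x y; apply/andP; split.
    exact: (level_lower_bound r0 (w1_ge0 _ _) (m_ge0 x y) (w1m _ _) mlo lo).
  exact: (level_upper_bound r0 D1 (w1_ge0 _ _) (m1 _) mhi hi).
rewrite !cut_sum_cross_side// !t0E !t1E !cut_sum_pull_cuts !cut_sumxx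
  mulr0 oppr0 expR0.
have -> : k * ((i == 0)%:R * 1 + (j == 0)%:R * 1) +
          k * ((i == 1)%:R * 1 + (j == 1)%:R * 1) = beta * r.
  by move: ij; case: (F2_cases i) (F2_cases j) => -> [] -> //= _; rewrite /k; field.
apply/andP; split; last exact: cross_upper_bound (m_ge0 x y) mhi.
rewrite addrC lerD// ler_peMl ?(ltW r0)//.
exact: cross_scale_ge1.
Qed.

Theorem corollary4p3 (R : realType) (Delta : R)
    (Delta_MN : mendel_naor_constant Delta)
    (Delta_le : Delta <=
       (2 * Num.sqrt 2 + 3) * expR 1 / (expR 1 - 1))
    (d : measure_display) (T : measurableType d)
    (mu : {measure set T -> \bar R})
    (M : set (LspaceType1 mu)) (M_finite : finite_set M)
    (r : R) (r_gt0 : 0 < r)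
    (w0 w1 : R -> R)
    (w0_modulus : concave_modulus w0)
    (w0_continuous : {within `[0, +oo[, continuous w0})
    (w1_modulus : concave_modulus w1)
    (w1_continuous : {within `[0, +oo[, continuous w1})
    (w01 : forall t, 0 < t -> `|w0 t - w1 t| <= 2 * r) :
  embeds_into_L1
    (twisted_union
       (fun x y : M => w0 (L1dist (set_val x) (set_val y)))
       (fun x y : M => w1 (L1dist (set_val x) (set_val y))) r)
    (1 + 2776 / 1000 * Delta) /\
  1 + 2776 / 1000 * Delta < 266 / 10.
Proof.
split; last exact: distortion_bound_lt.
pose n (x y : M) := L1dist (set_val x) (set_val y).
have n_ge0 x y : 0 <= n x y by exact: L1dist_ge0.
(* Writing the distance on [M] as a cut sum yields its symmetry and triangle inequality. *)
have [s s_ge0 nE] := finite_subset_L1_cut_sum id M_finite.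
have nxx x : n x x = 0 by rewrite /n nE cut_sumxx.
have nC x y : n x y = n y x by rewrite /n !nE cut_sumC.
have n_triangle x y z : n x z <= n x y + n y z.
  by rewrite /n !nE cut_sum_triangle.
have Delta_ge1 := mendel_naor_constant_ge1 Delta_MN.
have m_modulus := concave_modulus_min w0_modulus w1_modulus.
have w01' t : 0 <= t -> `|w0 t - w1 t| <= 2 * r.
  rewrite le_eqVlt => /predU1P[<-|/w01//].
  case: w0_modulus w1_modulus => [_ _ -> _] [_ _ -> _].
  by rewrite subrr normr0 mulr_ge0// ltW.
have w_triangle w x y z : concave_modulus w -> w (n x z) <= w (n x y) + w (n y z).
  move=> wc; apply: le_trans (concave_modulus_subadd wc (n_ge0 x y) (n_ge0 y z)).
  by case: wc => _ wmono _ _; apply: wmono => //; rewrite in_itv /= andbT ?addr_ge0.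
have wxx w x : concave_modulus w -> w (n x x) = 0.
  by case=> _ _ wz _; rewrite nxx.
have w_eq0 w x y : concave_modulus w -> w (n x y) <= 0 -> x = y.
  case=> _ _ _ wp wn; apply: val_inj; apply: L1dist_eq0.
  apply/eqP; move: (n_ge0 x y); rewrite le_eqVlt => /predU1P[/esym/eqP//|/wp].
  by rewrite ltNge wn.
set d0 := fun x y : M => w0 _; set d1 := fun x y : M => w1 _.
have tuE p q : twisted_union d0 d1 r p q = twisted_dist d0 d1 r p q.
  apply: twisted_unionE.
  - by move=> x; exact: (wxx _ x w0_modulus).
  - by move=> x; exact: (wxx _ x w1_modulus).
  - by move=> x y; rewrite /d0 -/(n x y) nC.
  - by move=> x y; rewrite /d1 -/(n x y) nC.
  - by move=> x y z; exact: (w_triangle _ x y z w0_modulus).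
  - by move=> x y z; exact: (w_triangle _ x y z w1_modulus).
  - by move=> x y z; exact: (w_triangle _ x y z m_modulus).
  - by move=> x y; apply: w01'; exact: n_ge0.
have [s0 s00 s0E] := modulus_cut_sum Delta_MN w0_modulus M_finite.
have [s1 s10 s1E] := modulus_cut_sum Delta_MN w1_modulus M_finite.
have [sm sm0 smE] := modulus_cut_sum Delta_MN m_modulus M_finite.
have [c c0 cE] := @twisted_union_cut_sum R Delta r M n w0 w1 sm s0 s1 r_gt0
  Delta_ge1 w01' (fun t => concave_modulus_ge0 w0_modulus)
  (fun t => concave_modulus_ge0 w1_modulus)
  n_ge0 sm0 s00 s10 smE s0E s1E.
have [d' [T' [mu' [F FE]]]] := cut_sum_L1 c0.
have Fbounds p q : twisted_union d0 d1 r p q <= L1dist (F p) (F q)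
    <= (1 + 2776 / 1000 * Delta) * twisted_union d0 d1 r p q.
  by rewrite tuE FE; exact: cE.
have D_ge0 : 0 < 1 + 2776 / 1000 * Delta by lra.
exists d', T', mu', F; split; last exact: distortion_le (ltW D_ge0) Fbounds.
split; last first.
  by exists 1, (1 + 2776 / 1000 * Delta); split=> // p q; rewrite mul1r.
(* Points with the same image have twisted distance at most 0: on one level the modulus then forces
   them to be equal, and across levels the distance is at least [r], which is positive. *)
move=> p q Fpq; have /andP[+ _] := Fbounds p q.
rewrite Fpq FE cut_sumxx tuE /twisted_dist; case: p q {Fpq} => x i [y j] /=.
case: eqVneq => [<-|_].
  by case: ifP => _ => [/(w_eq0 _ _ _ w0_modulus)->|/(w_eq0 _ _ _ w1_modulus)->].
rewrite leNgt ltr_wpDr// le_min.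
by rewrite /d0 /d1 !concave_modulus_ge0//; exact: n_ge0.
Qed.
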